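(* The finite projective Desarguesian plane $PG(2,9)$ of order $9$ is a Poncelet plane.
   Context: $PG(2,9)$ is the projective plane over the field $GF(9)$: points are nonzero column vectors $[x,y,z]^T$ over $GF(9)$ up to nonzero scalar multiples, lines are nonzero row vectors $[a,b,c]$ up to nonzero scalars, and $[x,y,z]^T$ lies on $[a,b,c]$ iff $ax+by+cz=0$. An oval in a plane of order $n$ is a set of $n+1$ points no three collinear. A secant of an oval $O$ is a line meeting $O$ in two points; a tangent is a line meeting $O$ in exactly one point. For an ordered pair of ovals $(O_t,O_s)$, an $m$-sided Poncelet polygon ($3\le m\le n+1$) is a cyclically ordered $m$-tuple of distinct points of $O_s$ such that each line joining cyclically consecutive vertices is a tangent of $O_t$. $(O_t,O_s)$ is a Poncelet $m$-pair ($3\le m\le n+1$) if an $m$-sided Poncelet polygon exists but no $m'$-sided one for $m'\ne m$, $3\le m'\le n+1$; a Poncelet $0$-pair if no secant of $O_s$ is a tangent of $O_t$; a Poncelet $\infty$-pair if some secant of $O_s$ is a tangent of $O_t$ but no $m$-sided Poncelet polygon ($3\le m\le n+1$) exists. A finite projective plane is a Poncelet plane if every pair of ovals in it is a Poncelet $m$-pair for some $3\le m\le n+1$, a Poncelet $0$-pair, or a Poncelet $\infty$-pair. *)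

(* Defs.v *)
From HB Require Import structures.
From mathcomp Require Import all_boot all_order all_algebra.
From mathcomp Require Import generic_quotient mxabelem.

Set Implicit Arguments.
Unset Strict Implicit.
Unset Printing Implicit Defensive.

Import GRing.Theory.
Local Open Scope ring_scope.

Definition collinear (P L : finType) (inc : P -> L -> bool) (p q r : P) : bool :=
  [exists l, [&& inc p l, inc q l & inc r l]].

Definition no_three_collinear (P L : finType) (inc : P -> L -> bool)
    (S : {set P}) : Prop :=
  forall p q r, p \in S -> q \in S -> r \in S ->
    p != q -> q != r -> p != r -> ~~ collinear inc p q r.

Record finProjPlane := FinProjPlane {
  point : finType;
  line : finType;
  inc : point -> line -> bool;
  plane_order : nat;
  joinP : forall p q, p != q -> exists! l, inc p l && inc q l;
  meetP : forall l m, l != m -> exists! p, inc p l && inc p m;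
  quadrangleP : exists S : {set point},
    #|S| = 4%N /\ no_three_collinear inc S;
  card_line : forall l, #|[set p | inc p l]| = plane_order.+1
}.

Arguments inc {f}.

Definition oval (P : finProjPlane) (O : {set point P}) : Prop :=
  #|O| = (plane_order P).+1 /\ no_three_collinear inc O.

Definition secant (P : finProjPlane) (O : {set point P}) (l : line P) : bool :=
  #|[set p in O | inc p l]| == 2%N.

Definition tangent (P : finProjPlane) (O : {set point P}) (l : line P) : bool :=
  #|[set p in O | inc p l]| == 1%N.

(* For p != q this says that the unique line pq is a tangent of O. *)
Definition tangent_join (P : finProjPlane) (O : {set point P}) : rel (point P) :=
  fun p q => [exists l, [&& inc p l, inc q l & tangent O l]].

Definition poncelet_polygon (P : finProjPlane) (Ot Os : {set point P}) (m : nat)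
    (s : m.-tuple (point P)) : Prop :=
  [/\ (3 <= m <= (plane_order P).+1)%N, uniq s, {subset s <= Os}
    & path.cycle (tangent_join Ot) s].

Definition has_poncelet_polygon (P : finProjPlane) (Ot Os : {set point P})
    (m : nat) : Prop :=
  exists s : m.-tuple (point P), poncelet_polygon Ot Os s.

Definition poncelet_pair (P : finProjPlane) (Ot Os : {set point P}) (m : nat) :
    Prop :=
  [/\ (3 <= m <= (plane_order P).+1)%N,
      has_poncelet_polygon Ot Os m
    & forall m', (3 <= m' <= (plane_order P).+1)%N -> m' != m ->
        ~ has_poncelet_polygon Ot Os m'].

Definition poncelet_0_pair (P : finProjPlane) (Ot Os : {set point P}) : Prop :=
  forall l, secant Os l -> ~~ tangent Ot l.

Definition poncelet_infty_pair (P : finProjPlane) (Ot Os : {set point P}) :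
    Prop :=
  (exists l, secant Os l && tangent Ot l) /\
  (forall m, (3 <= m <= (plane_order P).+1)%N -> ~ has_poncelet_polygon Ot Os m).

Definition poncelet_plane (P : finProjPlane) : Prop :=
  forall Ot Os : {set point P}, oval Ot -> oval Os ->
    [\/ exists m, poncelet_pair Ot Os m,
        poncelet_0_pair Ot Os
      | poncelet_infty_pair Ot Os].

Definition nzmx (F : finFieldType) (m n : nat) := {v : 'M[F]_(m, n) | v != 0}.

Definition prop_mx (F : finFieldType) (m n : nat) : rel (nzmx F m n) :=
  fun u v => [exists a : F, (a != 0) && (val v == a *: val u)].
Arguments prop_mx : clear implicits.

Lemma prop_mxP (F : finFieldType) m n (u v : nzmx F m n) :
  reflect (exists a, val v = a *: val u) (prop_mx F m n u v).
Proof.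
apply: (iffP existsP) => -[a]; first by case/andP=> _ /eqP; exists a.
move=> e; exists a; rewrite e eqxx andbT; apply: contraNneq (valP v) => a0.
by rewrite e a0 scale0r.
Qed.

Lemma prop_mx_refl F m n : reflexive (prop_mx F m n).
Proof. by move=> u; apply/prop_mxP; exists 1; rewrite scale1r. Qed.

Lemma prop_mx_sym F m n : symmetric (prop_mx F m n).
Proof.
have imp : forall u v, prop_mx F m n u v -> prop_mx F m n v u.
  move=> u v /existsP[a /andP[a0 /eqP e]]; apply/prop_mxP; exists a^-1.
  by rewrite e scalerA mulVf // scale1r.
by move=> u v; apply/idP/idP; apply: imp.
Qed.

Lemma prop_mx_trans F m n : transitive (prop_mx F m n).
Proof.
move=> v u w /prop_mxP[a ea] /prop_mxP[b eb]; apply/prop_mxP.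
by exists (b * a); rewrite eb ea scalerA.
Qed.

Canonical prop_mx_equiv F m n :=
  EquivRel (prop_mx F m n) (@prop_mx_refl F m n) (@prop_mx_sym F m n)
    (@prop_mx_trans F m n).

Definition proj (F : finFieldType) (m n : nat) :=
  {eq_quot prop_mx F m n}%qT.
HB.instance Definition _ (F : finFieldType) (m n : nat) :=
  EqQuotient.on (proj F m n).
HB.instance Definition _ (F : finFieldType) (m n : nat) :=
  Choice.on (proj F m n).
Lemma proj_reprK (F : finFieldType) (m n : nat) :
  @cancel (nzmx F m n) (proj F m n) repr (\pi_(proj F m n))%qT.
Proof. exact: reprK. Qed.
HB.instance Definition _ (F : finFieldType) (m n : nat) :=
  Countable.copy (proj F m n) (can_type (@proj_reprK F m n)).
HB.instance Definition _ (F : finFieldType) (m n : nat) :=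
  isFinite.Build (proj F m n)
    (@pcan_enumP (proj F m n : countType) _ _ _ (can_pcan (@proj_reprK F m n))).

(* Points are column vectors, lines are row vectors; independence of the
   chosen representatives is pg_inc_pi. *)
Definition pg_point (F : finFieldType) := proj F 3 1.
Definition pg_line (F : finFieldType) := proj F 1 3.
HB.instance Definition _ (F : finFieldType) := Finite.on (pg_point F).
HB.instance Definition _ (F : finFieldType) := Finite.on (pg_line F).

Definition pg_inc (F : finFieldType) (p : pg_point F) (l : pg_line F) : bool :=
  val (repr l) *m val (repr p) == 0.

Lemma proj_eq (F : finFieldType) m n (u v : nzmx F m n) :
  (\pi_(proj F m n) u == \pi_(proj F m n) v)%qT = prop_mx F m n u v.
Proof. by rewrite eqmodE. Qed.

Lemma prop_repr (F : finFieldType) m n (u : nzmx F m n) :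
  prop_mx F m n (repr (\pi_(proj F m n) u)%qT) u.
Proof. by rewrite -proj_eq reprK. Qed.

Lemma pg_inc_pi (F : finFieldType) (u : nzmx F 3 1) (w : nzmx F 1 3) :
  pg_inc (\pi_(proj F 3 1) u)%qT (\pi_(proj F 1 3) w)%qT
    = (val w *m val u == 0).
Proof.
have /existsP[a /andP[a0 /eqP ->]] := prop_repr u.
have /existsP[b /andP[b0 /eqP ->]] := prop_repr w.
by rewrite -scalemxAl -scalemxAr !scaler_eq0 (negPf a0) (negPf b0).
Qed.

Lemma rV3_kernel (F : finFieldType) (u v : 'rV[F]_3) :
  u != 0 -> v != 0 -> (forall a, v <> a *: u) ->
  exists2 w : 'rV[F]_3, w != 0
    & forall x : 'rV[F]_3,
        (u *m x^T == 0) && (v *m x^T == 0) <-> exists a, x = a *: w.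
Proof.
move=> u0 v0 uv.
have ltuv : (u < u + v)%MS.
  rewrite ltmxE addsmxSl addsmx_sub submx_refl /=.
  by apply/negP=> /sub_rVP[a]; apply: uv.
have rk : \rank (u + v)%MS = 2%N.
  apply/eqP; rewrite eqn_leq; apply/andP; split.
    by apply: leq_trans (mxrank_adds_leqif u v) _; rewrite !rank_rV u0 v0.
  by have := rank_ltmx ltuv; rewrite rank_rV u0.
pose K := kermx (col_mx u v)^T.
have rkK : \rank K = 1%N by rewrite mxrank_ker mxrank_tr -addsmxE rk.
pose w := nz_row K.
have w0 : w != 0 by rewrite nz_row_eq0 -mxrank_eq0 rkK.
exists w => // x.
have /eqmxP eK : (w == K)%MS.
  by rewrite -(geq_leqif (mxrank_leqif_eq (nz_row_sub K))) rkK rank_rV w0.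
have -> : (u *m x^T == 0) && (v *m x^T == 0) = (x <= w)%MS.
  rewrite eK sub_kermx -[x in RHS]trmxK -trmx_mul trmx_eq0 mul_col_mx.
  by rewrite col_mx_eq0.
by split=> /sub_rVP.
Qed.

Lemma pg_joinP (F : finFieldType) (p q : pg_point F) :
  p != q -> exists! l, pg_inc p l && pg_inc q l.
Proof.
rewrite -[p]reprK -[q]reprK; move: (repr p) (repr q) => u v.
rewrite proj_eq => /negP uv.
have [||a e|w w0 wP] := @rV3_kernel F (val u)^T (val v)^T.
- by rewrite trmx_eq0; apply: valP u.
- by rewrite trmx_eq0; apply: valP v.
- by apply: uv; apply/prop_mxP; exists a; apply: trmx_inj; rewrite linearZ.
have eq_inc (x : nzmx F 1 3) :
    (val x *m val u == 0) && (val x *m val v == 0)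
    <-> exists a, val x = a *: w.
  by have := wP (val x); rewrite -!trmx_mul !trmx_eq0.
exists (\pi_(proj F 1 3) (Sub w w0 : nzmx F 1 3))%qT; split.
  by rewrite !pg_inc_pi; apply/eq_inc; exists 1; rewrite scale1r.
move=> l; rewrite -[l]reprK !pg_inc_pi => /eq_inc[a e].
by apply/eqP; rewrite proj_eq; apply/prop_mxP; exists a.
Qed.

Lemma pg_meetP (F : finFieldType) (l m : pg_line F) :
  l != m -> exists! p, pg_inc p l && pg_inc p m.
Proof.
rewrite -[l]reprK -[m]reprK; move: (repr l) (repr m) => u v.
rewrite proj_eq => /negP uv.
have [||a e|w w0 wP] := @rV3_kernel F (val u) (val v).
- exact: valP u.
- exact: valP v.
- by apply: uv; apply/prop_mxP; exists a.
have eq_inc (x : nzmx F 3 1) :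
    (val u *m val x == 0) && (val v *m val x == 0)
    <-> exists a, val x = a *: w^T.
  rewrite -[val x]trmxK; split=> [/wP[a e]|[a e]]; last apply/wP; exists a.
    by rewrite e linearZ.
  by apply: trmx_inj; rewrite e linearZ.
have w0' : w^T != 0 by rewrite trmx_eq0.
exists (\pi_(proj F 3 1) (Sub w^T w0' : nzmx F 3 1))%qT; split.
  by rewrite !pg_inc_pi; apply/eq_inc; exists 1; rewrite scale1r.
move=> p; rewrite -[p]reprK !pg_inc_pi => /eq_inc[a e].
by apply/eqP; rewrite proj_eq; apply/prop_mxP; exists a.
Qed.

Lemma card_cV3_ker (F : finFieldType) (u : 'rV[F]_3) :
  u != 0 -> #|[set v : 'cV[F]_3 | u *m v == 0]| = (#|F| ^ 2)%N.
Proof.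
move=> u0; transitivity (#|F| ^ \rank (kermx u^T))%N; last first.
  by rewrite mxrank_ker mxrank_tr rank_rV u0.
rewrite -card_rowg -[LHS](card_imset _ (@trmx_inj F 3 1)).
apply: eq_card => x; rewrite mem_rowg sub_kermx.
rewrite -[x in RHS]trmxK -trmx_mul trmx_eq0.
apply/imsetP/idP => [[y]|h]; first by rewrite inE => h ->; rewrite trmxK.
by exists x^T; rewrite ?inE ?trmxK.
Qed.

Lemma card_pg_class (F : finFieldType) (p : pg_point F) :
  #|[set u : nzmx F 3 1 | \pi_(proj F 3 1) u == p]%qT| = #|F|.-1.
Proof.
rewrite -[p]reprK; move: (repr p) => u {p}.
rewrite -(card_imset _ val_inj) -(cardC1 (0 : F)).
have inj : injective (fun a : F => a *: val u).
  by move=> a b /eqP; rewrite -subr_eq0 -scalerBl scaler_eq0 (negPf (valP u))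
    orbF subr_eq0 => /eqP.
rewrite -(card_imset _ inj); apply: eq_card => x.
apply/imsetP/imsetP => [[v]|[a]]; rewrite inE.
  rewrite proj_eq prop_mx_sym => /existsP[a /andP[a0 /eqP e]] ->.
  by exists a.
move=> a0 ->; have au0 : a *: val u != 0 by rewrite scaler_eq0 negb_or a0 (valP u).
exists (Sub (a *: val u) au0) => //.
by rewrite inE proj_eq prop_mx_sym; apply/prop_mxP; exists a.
Qed.

Lemma pg_card_line (F : finFieldType) (l : pg_line F) :
  #|[set p | pg_inc p l]| = #|F|.+1.
Proof.
have q1 : (1 < #|F|)%N by apply: card_finNzRing_gt1.
pose S := [set u : nzmx F 3 1 | val (repr l) *m val u == 0].
have cS : #|S| = (#|F| ^ 2).-1.
  rewrite -(card_cV3_ker (valP (repr l))) (cardsD1 0) inE mulmx0 eqxx /=.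
  rewrite -(card_imset _ val_inj); apply: eq_card => x; rewrite !inE.
  apply/imsetP/andP => [[v]|[x0 h]]; first by rewrite inE => h ->; split=> //; apply: valP v.
  by exists (Sub x x0); rewrite ?inE.
have : #|S| = (#|[set p | pg_inc p l]| * #|F|.-1)%N.
  rewrite -sum1_card (partition_big (\pi_(proj F 3 1))%qT (fun p => pg_inc p l)).
    rewrite -sum_nat_const big_mkcond [RHS]big_mkcond; apply: eq_bigr => p _ /=.
    rewrite inE; case: ifP => // pl; rewrite sum1dep_card -(card_pg_class p).
    apply: eq_card => u; rewrite !inE andb_idl // => /eqP e.
    by rewrite -pg_inc_pi e reprK.
  by move=> u; rewrite inE => h; rewrite -[l]reprK pg_inc_pi.
rewrite cS -subn1 -[in LHS](exp1n 2) subn_sqr mulnC subn1 => /eqP.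
by rewrite eqn_pmul2r ?addn1 ?ltn_predRL // => /eqP.
Qed.

Definition frame_col (F : finFieldType) (k : 'I_4) : 'cV[F]_3 :=
  \col_i (if k == 3%N :> nat then 1 else (i == k :> nat)%:R).

Lemma frame_col_neq0 (F : finFieldType) (k : 'I_4) : frame_col F k != 0.
Proof.
have n10 : 1 <> 0 :> F by apply/eqP; apply: oner_neq0.
apply/eqP=> /matrixP e.
have := e (inord (if k == 3%N :> nat then 0%N else k)) 0.
rewrite !mxE; case: ifP => [_|k3].
  by move=> e10; apply: n10.
rewrite k3 inordK ?eqxx; first by move=> e10; apply: n10.
by have := ltn_ord k; rewrite ltnS leq_eqVlt k3.
Qed.

Definition frame_pt (F : finFieldType) (k : 'I_4) : pg_point F :=
  (\pi_(proj F 3 1) (Sub (frame_col F k) (frame_col_neq0 F k) : nzmx F 3 1))%qT.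

Lemma frame_pt_inj (F : finFieldType) : injective (@frame_pt F).
Proof.
move=> i j /eqP; rewrite proj_eq => /prop_mxP[a] /= /matrixP e.
have := e 0 0; have := e 1 0; have := e (inord 2) 0.
rewrite !mxE !inordK //.
have n01 : 0 <> 1 :> F by apply/eqP; rewrite eq_sym oner_eq0.
case: i {e} => [[|[|[|[|//]]]] ?]; case: j => [[|[|[|[|//]]]] ?] /=;
  rewrite ?mulr1n ?mulr0n ?mulr1 ?mulr0 => e0 e1 e2; try (by apply: val_inj);
  exfalso; apply: n01;
  first [exact: esym e0 | exact: esym e1 | exact: esym e2
        |exact: etrans e0 (esym e1)|exact: etrans e0 (esym e2)
        |exact: etrans e1 (esym e0)|exact: etrans e1 (esym e2)
        |exact: etrans e2 (esym e0)|exact: etrans e2 (esym e1)].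
Qed.

Lemma pg_quadrangle (F : finFieldType) :
  exists S : {set pg_point F}, #|S| = 4%N /\ no_three_collinear (@pg_inc F) S.
Proof.
exists (@frame_pt F @: setT).
rewrite card_imset ?cardsT ?card_ord; last exact: frame_pt_inj.
split=> // _ _ _ /imsetP[i _ ->] /imsetP[j _ ->] /imsetP[k _ ->].
rewrite !(inj_eq (@frame_pt_inj F)) => ij jk ik.
apply/existsP=> -[l]; rewrite -[l]reprK !pg_inc_pi /=.
have: val (repr l) != 0 by apply: (valP (repr l)).
set w := val _ => /eqP w0 zw; apply: w0.
have dot (x : 'I_4) : w *m frame_col F x == 0 ->
    (if x == 3%N :> nat then \sum_t w 0 t else w 0 (inord x)) = 0.
  move/eqP/matrixP/(_ 0 0); rewrite !mxE => e0; rewrite -[RHS]e0; case: ifP => x3.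
    by apply: eq_bigr => t _; rewrite !mxE x3 mulr1.
  have x3' : (x < 3)%N by have := ltn_ord x; rewrite ltnS leq_eqVlt x3.
  rewrite (bigD1 (inord x)) //= !mxE x3 inordK // eqxx mulr1 big1 ?addr0 // => t tx.
  rewrite !mxE x3; case: eqP => [e|_]; last by rewrite mulr0.
  by rewrite -val_eqE /= inordK // e eqxx in tx.
case/and3P: zw => /dot zi /dot zj /dot zk.
suff w012 : [/\ w 0 (inord 0) = 0, w 0 (inord 1) = 0 & w 0 (inord 2) = 0].
  case: w012 => w1 w2 w3; apply/matrixP=> r t; rewrite ord1 mxE -[t]inord_val.
  by case: t => [[|[|[|//]]] ?] /=.
move: ij jk ik zi zj zk {dot}.
have -> : \sum_t w 0 t = w 0 (inord 0) + (w 0 (inord 1) + w 0 (inord 2)).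
  rewrite !big_ord_recl big_ord0 addr0; congr (w 0 _ + (w 0 _ + w 0 _));
  by apply: val_inj; rewrite /= inordK.
case: i => [[|[|[|[|//]]]] ?]; case: j => [[|[|[|[|//]]]] ?];
case: k => [[|[|[|[|//]]]] ?] //= _ _ _ z1 z2 z3;
first [rewrite z2 z3 in z1 | rewrite z1 z3 in z2 | rewrite z1 z2 in z3];
by rewrite ?addr0 ?add0r in z1 z2 z3; split.
Qed.

Definition PG2 (F : finFieldType) : finProjPlane :=
  FinProjPlane (@pg_joinP F) (@pg_meetP F) (@pg_quadrangle F) (@pg_card_line F).

(* Main.v *)
Require Import Defs.
From mathcomp Require Import all_boot all_algebra.
From mathcomp Require Import generic_quotient finfield ring.

(* By a finite search (Segre's theorem for order 9), every oval is the image
   under GL_3 of the conic xy = z^2, parametrized by (t^2 : 1 : t) and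
   (1 : 0 : 0), and three of its points can be sent to the parameters oo, 0, 1.
   The tangents of an oval Ot are therefore zeros of a nondegenerate quadratic
   form on lines.  Evaluating this form on the secants of a parametrized oval Os
   makes a Poncelet polygon a cycle in a graph on the projective line over
   GF(9), whose edges are the zeros of a symmetric form of degree 2 in each
   variable.  Sending the first three vertices of a polygon to oo, 0, 1 leaves
   three coefficients, and a check of the 729 cases shows that whenever the form is
   nondegenerate all cycles of the graph have the same length. *)

Set Implicit Arguments.
Unset Strict Implicit.
Unset Printing Implicit Defensive.

Import GRing.Theory.
Local Open Scope ring_scope.

(** * A computable model of GF(9) *)

(* None, Some true and Some false stand for 0, 1 and -1 in GF(3); a pair (a, b)
   stands for a + b i in GF(9), where i^2 = -1. *)
Definition add3 (a b : option bool) : option bool :=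
  match a, b with
  | None, _ => b
  | _, None => a
  | Some x, Some y => if x (+) y then None else Some (~~ x)
  end.

Definition mul3 (a b : option bool) : option bool :=
  match a, b with
  | Some x, Some y => Some (~~ (x (+) y))
  | _, _ => None
  end.

Definition opp3 : option bool -> option bool := omap negb.

Notation gf9 := (option bool * option bool)%type.

Definition add9 (u v : gf9) : gf9 := (add3 u.1 v.1, add3 u.2 v.2).
Definition opp9 (u : gf9) : gf9 := (opp3 u.1, opp3 u.2).
Definition mul9 (u v : gf9) : gf9 :=
  (add3 (mul3 u.1 v.1) (opp3 (mul3 u.2 v.2)), add3 (mul3 u.1 v.2) (mul3 u.2 v.1)).
Definition zero9 : gf9 := (None, None).
Definition one9 : gf9 := (Some true, None).

Definition enum3 : seq (option bool) := [:: None; Some true; Some false].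
Definition enum9 : seq gf9 := [seq (a, b) | a <- enum3, b <- enum3].

Lemma mem_enum9 u : u \in enum9.
Proof. by case: u => [[[]|] [[]|]]. Qed.

Lemma add9_opp_eq0 u v : (add9 u (opp9 v) == zero9) = (u == v).
Proof. by case: u => [[[]|] [[]|]]; case: v => [[[]|] [[]|]]. Qed.

Lemma mul9_inv u : u != zero9 -> exists v, mul9 u v = one9.
Proof.
have /allP/(_ u (mem_enum9 u)) :
    all (fun u => (u == zero9) || has (fun v => mul9 u v == one9) enum9) enum9 by [].
by case: eqP => // _ /hasP[v _ /eqP] uv _; exists v.
Qed.

(** * Exhaustive searches *)

(** Depth-first search: [visited] is meant to list a path from [v0] to [v], both ends included, and
    [n] bounds the number of vertices still to be added. A length is recorded whenever an edge
    closes the path to a cycle of at least three vertices. *)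
Fixpoint cycle_sizes (T : eqType) (nb : T -> seq T) (v0 : T) (n : nat)
    (visited : seq T) (v : T) : seq nat :=
  (if (2 < size visited)%N && (v0 \in nb v) then [:: size visited] else [::]) ++
  (if n is n'.+1 then
     flatten [seq cycle_sizes nb v0 n' (w :: visited) w
             | w <- [seq w <- nb v | w \notin visited]]
   else [::]).

Lemma mem_cycle_sizes (T : eqType) (nb : T -> seq T) v0 n visited v s :
  path (fun x y => y \in nb x) v s -> v0 \in nb (last v s) ->
  uniq (s ++ visited) -> (size s <= n)%N -> (2 < size s + size visited)%N ->
  (size s + size visited)%N \in cycle_sizes nb v0 n visited v.
Proof.
have base n' vis v' : v0 \in nb v' -> (2 < size vis)%N ->
    size vis \in cycle_sizes nb v0 n' vis v'.
  by move=> lv sz; case: n' => [|n'] /=; rewrite lv sz /= inE eqxx.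
elim: s n visited v => [|w s IHs] n visited v; first by move=> _ ? _ _ ?; apply: base.
case: n => [|n] /=; first by [].
rewrite ltnS.
move=> /andP[vw ws] wlast /andP[wNs us] sn sz.
have [wNs' wNv] : w \notin s /\ w \notin visited.
  by apply/norP; rewrite -mem_cat.
rewrite mem_cat; apply/orP; right.
apply/flatten_mapP; exists w; first by rewrite mem_filter wNv.
rewrite addSnnS; apply: (IHs n (w :: visited)) => //; last by rewrite /= -addSnnS.
by rewrite -[_ :: _]cat1s uniq_catCA /= mem_cat negb_or wNs' wNv.
Qed.

(** * Cycle lengths in the graphs on the projective line *)

Definition vertices9 : seq (option gf9) := None :: [seq Some u | u <- enum9].

(** [None] is the parameter at infinity; its formula is the coefficient of s^2 in the polynomial of
    the finite case. *)
Definition edge9 (b d f : gf9) (s t : option gf9) : bool :=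
  match s, t with
  | Some s, Some t =>
    let p := mul9 s t in let q := add9 s t in
    add9 (add9 (mul9 b (mul9 p p)) (add9 one9 (opp9 (mul9 d p))))
      (add9 (mul9 f (mul9 p q)) (opp9 q)) == zero9
  | None, Some t | Some t, None => mul9 t (add9 (mul9 b t) f) == zero9
  | None, None => false
  end.

(** The adjacency lists are tabulated once, so that the search does not evaluate the form again at
    each step. *)
Definition uniform_cycles (b d f : gf9) : bool :=
  let adj := [seq [seq t <- vertices9 | edge9 b d f s t] | s <- vertices9] in
  let nb v := nth [::] adj (index v vertices9) in
  constant (flatten [seq cycle_sizes nb v 9 [:: v] v | v <- vertices9]).

(** The determinant, in characteristic 3, of the symmetric matrix with rows (1, d, -1), (d, b, f),
    (-1, f, 0), whose quadratic form defines the edges. *)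
Definition det9 (b d f : gf9) : gf9 := add9 (mul9 f (add9 d (opp9 f))) (opp9 b).

Lemma uniform_cycles_all :
  all (fun b => all (fun d => all (fun f =>
    (det9 b d f == zero9) || uniform_cycles b d f) enum9) enum9) enum9.
Proof. by vm_compute. Qed.

Lemma mem_vertices9 v : v \in vertices9.
Proof.
by case: v => [u|//]; rewrite in_cons; apply/orP; right; apply/map_f/mem_enum9.
Qed.

Lemma edge9_cycles_same_size b d f c c' :
  det9 b d f != zero9 ->
  uniq c -> (2 < size c)%N -> path.cycle (edge9 b d f) c ->
  uniq c' -> (2 < size c')%N -> path.cycle (edge9 b d f) c' ->
  size c = size c'.
Proof.
move=> det_neq0.
pose adj := [seq [seq t <- vertices9 | edge9 b d f s t] | s <- vertices9].
pose nb v := nth [::] adj (index v vertices9).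
pose sizes := flatten [seq cycle_sizes nb v 9 [:: v] v | v <- vertices9].
have /(constantP 0%N)[m sizesE] : constant sizes.
  have /allP/(_ b (mem_enum9 b)) := uniform_cycles_all.
  move/allP/(_ d (mem_enum9 d))/allP/(_ f (mem_enum9 f)).
  by rewrite (negPf det_neq0).
have nbE s t : (t \in nb s) = edge9 b d f s t.
  rewrite /nb /adj (nth_map None) ?index_mem ?mem_vertices9 //.
  by rewrite nth_index ?mem_vertices9 // mem_filter mem_vertices9 andbT.
have mem_sizes x : uniq x -> (2 < size x)%N -> path.cycle (edge9 b d f) x ->
    size x \in sizes.
  case: x => [//|v s] /= /andP[vNs us] sz; rewrite rcons_path => /andP[ps lasts].
  apply/flatten_mapP; exists v; first exact: mem_vertices9.
  rewrite -addn1 -[1%N]/(size [:: v]); apply: mem_cycle_sizes.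
  - by rewrite (eq_path nbE).
  - by rewrite nbE.
  - by rewrite cats1 rcons_uniq vNs.
  (* There are ten vertices in all, so at most nine follow [v] and the search is deep enough. *)
  - have /uniq_leq_size/(_ (fun w _ => mem_vertices9 w)) : uniq (v :: s).
      by rewrite /= vNs.
    by [].
  - by rewrite addn1.
move=> uc sc ec uc' sc' ec'.
move: (mem_sizes c uc sc ec) (mem_sizes c' uc' sc' ec').
by rewrite sizesE !mem_nseq => /andP[_ /eqP ->] /andP[_ /eqP ->].
Qed.

(** * Arcs through the infinite points of the axes *)

Definition collinear9 (p q r : gf9 * gf9) : bool :=
  mul9 (add9 q.1 (opp9 p.1)) (add9 r.2 (opp9 p.2)) ==
  mul9 (add9 r.1 (opp9 p.1)) (add9 q.2 (opp9 p.2)).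

(** The infinite points of both axes tacitly belong to the arc: hence the condition on ordinates,
    while the search takes each abscissa only once. *)
Definition extends_arc (a : seq (gf9 * gf9)) (p : gf9 * gf9) : bool :=
  all (fun q => (q.2 != p.2) &&
    all (fun r => (q != r) ==> ~~ collinear9 p q r) a) a.

(** Each abscissa in [xs] receives in turn every nonzero ordinate that keeps the arc property; each
    leaf tests that all points lie on the hyperbola xy = 1. *)
Fixpoint hyperbola_forced (xs : seq gf9) (a : seq (gf9 * gf9)) : bool :=
  if xs is x :: xs' then
    all (fun y => hyperbola_forced xs' ((x, y) :: a))
      [seq y <- behead enum9 | extends_arc a (x, y)]
  else all (fun p => mul9 p.1 p.2 == one9) a.

Definition abscissas9 : seq gf9 := [seq u <- behead enum9 | u != one9].

Lemma hyperbola_forced_abscissas9 :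
  hyperbola_forced abscissas9 [:: (one9, one9)].
Proof. by vm_compute. Qed.

Section Search.

Variable f : gf9 -> gf9.
Hypothesis f_neq0 : forall x, x != zero9 -> f x != zero9.
Hypothesis f_inj : forall x y, x != zero9 -> y != zero9 -> x != y -> f x != f y.
Hypothesis f_arc : forall x y z, x != zero9 -> y != zero9 -> z != zero9 ->
  x != y -> y != z -> x != z -> ~~ collinear9 (x, f x) (y, f y) (z, f z).

(** Follow the branch that gives each [x] the ordinate [f x]: the hypotheses on [f] keep it from
    being pruned, so the test at its leaf applies. The induction moves [x] from the pending list
    [xs] to the assigned list [l]. *)
Lemma hyperbola_forcedP xs l :
  uniq (xs ++ l) -> zero9 \notin xs ++ l ->
  hyperbola_forced xs [seq (x, f x) | x <- l] ->
  {in xs ++ l, forall x, mul9 x (f x) = one9}.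
Proof.
elim: xs l => [|x xs IHxs] l.
  move=> _ _ /allP h x xl.
  by have /eqP := h _ (map_f (fun x => (x, f x)) xl).
rewrite cat_cons cons_uniq inE negb_or eq_sym => /andP[xN u] /andP[x0 z0].
have neq0 y : y \in xs ++ l -> y != zero9 by apply: contraTneq => ->.
have fx : f x \in behead enum9.
  by have := mem_enum9 (f x); rewrite inE (negPf (f_neq0 x0)).
move/allP/(_ (f x)); rewrite mem_filter fx andbT => forced.
have ext : extends_arc [seq (x, f x) | x <- l] (x, f x).
  apply/allP=> _ /mapP[y yl ->] /=.
  have [ynx y0] : y != x /\ y != zero9.
    split; last by apply: neq0; rewrite mem_cat yl orbT.
    by apply: contraNneq xN => <-; rewrite mem_cat yl orbT.
  rewrite f_inj //=; apply/allP=> _ /mapP[z zl ->]; apply/implyP=> yz.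
  have [znx z0'] : z != x /\ z != zero9.
    split; last by apply: neq0; rewrite mem_cat zl orbT.
    by apply: contraNneq xN => <-; rewrite mem_cat zl orbT.
  apply: f_arc => //; [by rewrite eq_sym| |by rewrite eq_sym].
  by apply: contraNneq yz => ->.
have memE y : (y \in x :: xs ++ l) = (y \in xs ++ (x :: l)).
  by rewrite !(mem_cat, inE) orbCA.
move=> y; rewrite memE; apply: IHxs.
- by rewrite -[x :: l]cat1s uniq_catCA /= xN.
- by rewrite -memE inE negb_or eq_sym x0.
- exact: forced ext.
Qed.

Lemma hyperbola9 : f one9 = one9 -> forall x, x != zero9 -> mul9 x (f x) = one9.
Proof.
move=> f1 x x0; apply: (@hyperbola_forcedP abscissas9 [:: one9]).
- by [].
- by [].
- have -> : [seq (x, f x) | x <- [:: one9]] = [:: (one9, one9)] by rewrite /= f1.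
  exact: hyperbola_forced_abscissas9.
rewrite mem_cat mem_filter mem_seq1 orbC; case: eqP => //= _.
by have := mem_enum9 x; rewrite inE (negPf x0).
Qed.

End Search.

(** * Transfer to a field of order 9 *)

Section Order9.

Variable F : finFieldType.
Hypothesis hF : #|F| = 9%N.

Lemma nat3_eq0 : 3%:R = 0 :> F.
Proof. by apply: pcharf0; apply: (@card_finPcharP _ 3 2). Qed.

Lemma addr11 : 1 + 1 = -1 :> F.
Proof. by apply/eqP; rewrite -addr_eq0 -nat3_eq0 !mulrS mulr0n addr0 addrA. Qed.

(** At most five elements satisfy x^5 = x. For any other x, the factorization x^9 - x = (x^5 -
    x)(x^4 + 1) gives x^4 = -1, so x^2 is a root. *)
Lemma sqrt_opp1 : exists i : F, i * i = -1.
Proof.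
have [x hx] : exists x : F, x ^+ 5 != x.
  apply/existsP; apply: contraT; rewrite negb_exists => /forallP h.
  have sz : size ('X^5 - 'X : {poly F}) = 6.
    by rewrite size_polyDl size_polyXn // size_polyN size_polyX.
  have := @max_poly_roots F ('X^5 - 'X) (enum F).
  rewrite -size_poly_eq0 sz -cardE hF enum_uniq.
  move=> /(_ isT) roots5; suff /roots5/(_ isT) : all (root ('X^5 - 'X)) (enum F) by [].
  apply/allP=> x _.
  by have := h x; rewrite negbK rootE !hornerE subr_eq0.
exists (x ^+ 2); apply/eqP; rewrite -addr_eq0.
have /eqP : (x ^+ 5 - x) * (x ^+ 2 * x ^+ 2 + 1) = 0.
  have e : x ^+ 9 = x by rewrite -[in RHS](expf_card x) hF.
  rewrite mulrBl !mulrDr !mulr1 -!exprD -exprS e; ring.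
by rewrite mulf_eq0 subr_eq0 (negPf hx).
Qed.

(** The map (a, b) -> a + b i respects the operations; it is injective because nonzero elements of
    the model have inverses, and bijective by counting. *)
Lemma gf9_iso : exists phi : gf9 -> F, exists psi : F -> gf9,
  [/\ cancel phi psi, cancel psi phi, {morph phi : u v / add9 u v >-> u + v},
      {morph phi : u v / mul9 u v >-> u * v} & {morph phi : u / opp9 u >-> - u}]
  /\ (phi zero9 = 0 /\ phi one9 = 1).
Proof.
have [i i2] := sqrt_opp1.
pose phi3 (a : option bool) : F := if a is Some b then if b then 1 else -1 else 0.
have add3P : {morph phi3 : a b / add3 a b >-> a + b}.
  by move=> [[]|] [[]|]; rewrite /= ?add0r ?addr0 ?subrr ?addNr ?addr11 // -opprD addr11 opprK.
have mul3P : {morph phi3 : a b / mul3 a b >-> a * b}.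
  by move=> [[]|] [[]|]; rewrite /= ?mul0r ?mulr0 ?mulr1 ?mul1r ?mulrNN ?mulr1.
have opp3P : {morph phi3 : a / opp3 a >-> - a}.
  by move=> [[]|]; rewrite /= ?oppr0 ?opprK.
pose phi (u : gf9) : F := phi3 u.1 + i * phi3 u.2.
have addP : {morph phi : u v / add9 u v >-> u + v}.
  by move=> u v; rewrite /phi /= !add3P; ring.
have oppP : {morph phi : u / opp9 u >-> - u}.
  by move=> u; rewrite /phi /= !opp3P; ring.
have mulP : {morph phi : u v / mul9 u v >-> u * v}.
  move=> u v; rewrite /phi /= !add3P opp3P !mul3P.
  (* Replacing -1 by i^2 leaves an identity valid in every commutative ring. *)
  by rewrite -[- _]mulN1r -i2; ring.
have phi0 : phi zero9 = 0 by rewrite /phi /= mulr0 addr0.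
have phi1 : phi one9 = 1 by rewrite /phi /= mulr0 addr0.
have phiN0 u : u != zero9 -> phi u != 0.
  move=> u0; have [v uv] := mul9_inv u0.
  by apply: contraTneq (oner_neq0 F) => pu; rewrite -phi1 -uv mulP pu mul0r eqxx.
have phi_inj : injective phi.
  move=> u v e; apply/eqP; rewrite -add9_opp_eq0; apply: contraT => /phiN0.
  by rewrite addP oppP e subrr eqxx.
have [|psi phiK psiK] := inj_card_bij phi_inj; last by exists phi, psi.
by rewrite hF card_prod card_option card_bool.
Qed.

(* The form x^2 + b y^2 - d x y + x z - f y z evaluated at
   [conic_secant s t]. *)
Definition edge (b d f : F) (s t : option F) : bool :=
  match s, t with
  | Some s, Some t =>
    1 + b * (s * t) ^+ 2 - d * (s * t) - (s + t) + f * (s * t) * (s + t) == 0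
  | None, Some t | Some t, None => t * (b * t + f) == 0
  | None, None => false
  end.

Lemma edge_cycles_same_size b d f c c' :
  f * (d - f) - b != 0 ->
  uniq c -> (2 < size c)%N -> path.cycle (edge b d f) c ->
  uniq c' -> (2 < size c')%N -> path.cycle (edge b d f) c' ->
  size c = size c'.
Proof.
have [phi [psi [[phiK psiK phiD phiM phiN] [phi0 phi1]]]] := gf9_iso.
have eq0 u : (u == zero9) = (phi u == 0).
  by rewrite -phi0 (inj_eq (can_inj phiK)).
have edgeE s t : edge b d f s t =
    edge9 (psi b) (psi d) (psi f) (omap psi s) (omap psi t).
  case: s t => [s|] [t|] //=; rewrite eq0 !(phiM, phiD, phiN, phi1) !psiK //.
  by congr (_ == _); ring.
have cycleE x : path.cycle (edge b d f) x =
    path.cycle (edge9 (psi b) (psi d) (psi f)) (map (omap psi) x).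
  by rewrite cycle_map; apply: eq_cycle => s t; rewrite edgeE.
have opsi_inj : injective (omap psi).
  by move=> [s|] [t|] //= [/(can_inj psiK) ->].
move=> det_neq0; rewrite !cycleE -!(size_map (omap psi)) -!(map_inj_uniq opsi_inj).
apply: edge9_cycles_same_size.
by rewrite eq0 !(phiM, phiD, phiN) !psiK.
Qed.

Lemma hyperbola (f : F -> F) :
  (forall x, x != 0 -> f x != 0) ->
  (forall x y, x != 0 -> y != 0 -> x != y -> f x != f y) ->
  (forall x y z, x != 0 -> y != 0 -> z != 0 -> x != y -> y != z -> x != z ->
    (y - x) * (f z - f x) != (z - x) * (f y - f x)) ->
  f 1 = 1 -> forall x, x != 0 -> x * f x = 1.
Proof.
have [phi [psi [[phiK psiK phiD phiM phiN] [phi0 phi1]]]] := gf9_iso.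
have phi_inj := can_inj phiK.
have neq0 u : (u != zero9) = (phi u != 0) by rewrite -phi0 (inj_eq phi_inj).
move=> f_neq0 f_inj f_arc f1 x x0.
rewrite -{1 2}[x]psiK -[f _]psiK -phiM -phi1; congr phi.
apply: (@hyperbola9 (fun u => psi (f (phi u)))) => [u|u v|u v w||].
- by rewrite !neq0 psiK; apply: f_neq0.
- rewrite !neq0 -(inj_eq phi_inj) => u0 v0 uv.
  by rewrite (can_eq psiK); apply: f_inj.
- rewrite !neq0 -3!(inj_eq phi_inj) => u0 v0 w0 uv vw uw.
  rewrite /collinear9 -(inj_eq phi_inj) /= !(phiM, phiD, phiN) !psiK.
  exact: f_arc.
- by rewrite phi1 f1 -phi1 phiK.
- by rewrite neq0 psiK.
Qed.

End Order9.

(** * Coordinates and the standard conic *)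

Section Coordinates.

Variable F : finFieldType.

Definition cv (x y z : F) : 'cV[F]_3 := \col_i nth 0 [:: x; y; z] i.
Definition rv (x y z : F) : 'rV[F]_3 := \row_i nth 0 [:: x; y; z] i.

Definition i0 : 'I_3 := @Ordinal 3 0 isT.
Definition i1 : 'I_3 := @Ordinal 3 1 isT.
Definition i2 : 'I_3 := @Ordinal 3 2 isT.

Lemma cv_eta (v : 'cV[F]_3) : v = cv (v i0 0) (v i1 0) (v i2 0).
Proof.
apply/matrixP=> i j; rewrite mxE ord1.
by case: i => [[|[|[|//]]] ?] /=; congr (v _ _); apply: val_inj.
Qed.

Lemma rv_eta (v : 'rV[F]_3) : v = rv (v 0 i0) (v 0 i1) (v 0 i2).
Proof.
apply/matrixP=> j i; rewrite mxE ord1.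
by case: i => [[|[|[|//]]] ?] /=; congr (v _ _); apply: val_inj.
Qed.

Lemma sum3 (f : 'I_3 -> F) : \sum_i f i = f i0 + f i1 + f i2.
Proof.
rewrite !big_ord_recl big_ord0 addr0 addrA.
by congr (f _ + f _ + f _); apply: val_inj.
Qed.

Lemma rv_mul_cv x y z x' y' z' :
  (rv x y z *m cv x' y' z' == 0) = (x * x' + y * y' + z * z' == 0).
Proof.
apply/eqP/eqP => [/matrixP/(_ 0 0)|e]; first by rewrite !mxE sum3 !mxE.
by apply/matrixP=> i j; rewrite !ord1 !mxE sum3 !mxE.
Qed.

Lemma scale_cv a x y z : a *: cv x y z = cv (a * x) (a * y) (a * z).
Proof. by rewrite [LHS]cv_eta !mxE. Qed.

Lemma scale_rv a x y z : a *: rv x y z = rv (a * x) (a * y) (a * z).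
Proof. by rewrite [LHS]rv_eta !mxE. Qed.

Lemma cv_eq0 x y z : (cv x y z == 0) = [&& x == 0, y == 0 & z == 0].
Proof.
apply/eqP/and3P => [/matrixP e|[/eqP-> /eqP-> /eqP->]].
  by have := e i0 0; have := e i1 0; have := e i2 0; rewrite !mxE /= => -> -> ->.
by rewrite [LHS]cv_eta [RHS]cv_eta !mxE.
Qed.

Lemma rv_eq0 x y z : (rv x y z == 0) = [&& x == 0, y == 0 & z == 0].
Proof.
apply/eqP/and3P => [/matrixP e|[/eqP-> /eqP-> /eqP->]].
  by have := e 0 i0; have := e 0 i1; have := e 0 i2; rewrite !mxE /= => -> -> ->.
by rewrite [LHS]rv_eta [RHS]rv_eta !mxE.
Qed.

(** The first frame vector is the default for [v = 0]; the lemmas on [pt] assume [v != 0]. *)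
Definition pt (v : 'cV[F]_3) : pg_point F :=
  (\pi_(proj F 3 1) (insubd (Sub (frame_col F ord0) (frame_col_neq0 F ord0)) v
     : nzmx F 3 1))%qT.

Lemma pt_eq (p : pg_point F) v a :
  v != 0 -> v = a *: val (repr p) -> p = pt v.
Proof.
move=> v0 e; rewrite -[LHS]reprK; apply/eqP; rewrite /pt proj_eq.
by apply/prop_mxP; exists a; rewrite val_insubd v0.
Qed.

Lemma pg_inc_pt v (l : pg_line F) :
  v != 0 -> pg_inc (pt v) l = (val (repr l) *m v == 0).
Proof. by move=> v0; rewrite -[l in LHS]reprK pg_inc_pi val_insubd v0. Qed.

Lemma pg_collinear (r : 'rV[F]_3) (p q s : pg_point F) :
  r != 0 -> r *m val (repr p) = 0 -> r *m val (repr q) = 0 ->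
  r *m val (repr s) = 0 -> collinear (@pg_inc F) p q s.
Proof.
move=> r0 rp rq rs; apply/existsP.
exists (\pi_(proj F 1 3) (Sub r r0 : nzmx F 1 3))%qT.
by rewrite -[p]reprK -[q]reprK -[s]reprK !pg_inc_pi /= rp rq rs eqxx.
Qed.

Definition conic_pt (t : option F) : 'cV[F]_3 :=
  if t is Some t then cv (t * t) 1 t else cv 1 0 0.

(** At the conic point of finite parameter u the row evaluates to (u - s)(u - t), or to t - u if one
    of the two parameters is infinite. *)
Definition conic_secant (s t : option F) : 'rV[F]_3 :=
  match s, t with
  | Some s, Some t => rv 1 (s * t) (- (s + t))
  | None, Some t | Some t, None => rv 0 t (-1)
  | None, None => rv 0 1 0
  end.

Lemma conic_pt_neq0 t : conic_pt t != 0.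
Proof. by case: t => [t|]; rewrite cv_eq0 oner_eq0 ?andbF. Qed.

(** A line (a, b, c) meets the conic where a u^2 + c u + b vanishes, and two roots determine this
    polynomial up to a factor. *)
Lemma conic_secantP (r : 'rV[F]_3) s t :
  s != t -> r *m conic_pt s = 0 -> r *m conic_pt t = 0 ->
  exists a, r = a *: conic_secant s t.
Proof.
rewrite [r]rv_eta; move: (r 0 i0) (r 0 i1) (r 0 i2) => a b c.
move=> st /eqP rs /eqP rt; move: rs rt st.
case: s t => [s|] [t|] //=; rewrite !rv_mul_cv ?mulr1 ?mulr0 ?addr0 => /eqP e1 /eqP e2 st.
- have st0 : s - t != 0 by rewrite subr_eq0; apply: contra st => /eqP ->.
  have ec : c = - (a * (s + t)).
    apply: (mulfI st0); apply/eqP; rewrite -subr_eq0; apply/eqP.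
    transitivity (a * (s * s) + b + c * s - (a * (t * t) + b + c * t)); first by ring.
    by rewrite e1 e2 subrr.
  have eb : b = a * (s * t).
    by apply/eqP; rewrite -subr_eq0 -e1 ec; apply/eqP; ring.
  by exists a; rewrite scale_rv ec eb; congr rv; ring.
- exists (- c); rewrite scale_rv e2; congr rv; [ring| |ring].
  by apply/eqP; rewrite -subr_eq0 -e1 e2; apply/eqP; ring.
- exists (- c); rewrite scale_rv e1; congr rv; [ring| |ring].
  by apply/eqP; rewrite -subr_eq0 -e2 e1; apply/eqP; ring.
Qed.

(** The polynomial a t^2 + c t + b has a double root, at infinity if a = c = 0, so its discriminant
    vanishes. *)
Lemma conic_tangent (r : 'rV[F]_3) t0 :
  (forall t, (r *m conic_pt t == 0) = (t == t0)) ->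
  r 0 i2 ^+ 2 = 4%:R * r 0 i0 * r 0 i1.
Proof.
rewrite [r]rv_eta; move: (r 0 i0) (r 0 i1) (r 0 i2) => a b c r_conic; rewrite !mxE /=.
have := r_conic t0; rewrite eqxx.
case: t0 r_conic => [t|] r_conic; rewrite rv_mul_cv ?mulr1 ?mulr0 ?addr0 => /eqP e.
  have := r_conic None; rewrite rv_mul_cv mulr1 !mulr0 !addr0 => /negbT a0.
  (* By Vieta this is the second root, so it must coincide with [t]. *)
  have := r_conic (Some (- c / a - t)).
  rewrite rv_mul_cv mulr1.
  have -> : a * ((- c / a - t) * (- c / a - t)) + b + c * (- c / a - t) =
      a * (t * t) + b + c * t by field.
  rewrite e eqxx => /esym/eqP[ec].
  have {}ec : c = - (2%:R * a * t).
    apply/eqP; rewrite -subr_eq0; apply/eqP.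
    transitivity (a * (t - (- c / a - t))); first by field.
    by rewrite ec subrr mulr0.
  have eb : b = a * t ^+ 2.
    by apply/eqP; rewrite -subr_eq0 -e ec; apply/eqP; ring.
  by rewrite eb ec; ring.
have := r_conic (Some (- b / c)).
rewrite rv_mul_cv e mul0r add0r mulr1 => h.
have [->|c0] := eqVneq c 0; first by ring.
by move: h; rewrite mulrC divfK // subrr eqxx.
Qed.

End Coordinates.

(** * Ovals are conics *)

Lemma missing_value (T F : finType) (A : {set T}) (f : T -> F) :
  {in A &, injective f} -> #|F| = #|A|.+1 ->
  exists x0, forall x, (x \in f @: A) = (x != x0).
Proof.
move=> f_inj cF; have /eqP/cards1P[x0 e] : #|~: (f @: A)| = 1%N.
  by apply/eqP; rewrite -(eqn_add2l #|f @: A|) cardsC card_in_imset // cF addn1.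
by exists x0 => x; rewrite -in_set1 -e inE negbK.
Qed.

Section Oval.

Variable F : finFieldType.
Hypothesis hF : #|F| = 9%N.
Variable O : {set pg_point F}.
Hypothesis hO : @oval (PG2 F) O.

(** In the original coordinates the line is [r *m A], and no line contains three points of the
    oval. *)
Lemma oval_no_line (A : 'M[F]_3) (r : 'rV[F]_3) (p q s : pg_point F) :
  A \in unitmx -> r != 0 -> p \in O -> q \in O -> s \in O ->
  p != q -> q != s -> p != s ->
  r *m (A *m val (repr p)) = 0 -> r *m (A *m val (repr q)) = 0 ->
  r *m (A *m val (repr s)) != 0.
Proof.
move=> uA r0 pO qO sO pq qs ps rp rq; apply/eqP=> rs.
have [_ /(_ p q s pO qO sO pq qs ps) /negP] := hO; apply.
apply: (@pg_collinear _ (r *m A)); rewrite -?mulmxA //.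
by apply: contraNneq r0 => e; rewrite -(mulmxK uA r) e mul0mx.
Qed.

Variables p1 p2 p3 : pg_point F.
Hypotheses (p1O : p1 \in O) (p2O : p2 \in O) (p3O : p3 \in O).
Hypotheses (p12 : p1 != p2) (p23 : p2 != p3) (p13 : p1 != p3).

Lemma oval_frame : exists A : 'M[F]_3,
  [/\ A \in unitmx, A *m val (repr p1) = cv 1 0 0,
      A *m val (repr p2) = cv 0 1 0 & A *m val (repr p3) = cv 0 0 1].
Proof.
pose p (j : 'I_3) := nth p1 [:: p1; p2; p3] j.
pose M : 'M[F]_3 := \matrix_(i, j) val (repr (p j)) i 0.
have colM j : col j M = val (repr (p j)).
  by apply/matrixP=> i k; rewrite !mxE ord1.
have uM : M \in unitmx.
  (* A nonzero row killed by [M] would be a line through [p1], [p2] and [p3]. *)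
  rewrite -row_free_unit -kermx_eq0 -nz_row_eq0; apply: contraT => r0.
  have rM : nz_row (kermx M) *m M = 0 by apply/sub_kermxP/nz_row_sub.
  have rp j : nz_row (kermx M) *m (1%:M *m val (repr (p j))) = 0.
    by rewrite mul1mx -colM colE mulmxA rM mul0mx.
  have := @oval_no_line 1%:M _ p1 p2 p3 (unitmx1 _ _) r0 p1O p2O p3O p12 p23 p13
    (rp i0) (rp i1).
  by rewrite (rp i2) eqxx.
exists (invmx M); rewrite unitmx_inv; split=> //.
- by rewrite -(colM i0) colE mulKmx // [LHS]cv_eta !mxE.
- by rewrite -(colM i1) colE mulKmx // [LHS]cv_eta !mxE.
- by rewrite -(colM i2) colE mulKmx // [LHS]cv_eta !mxE.
Qed.

(** Send [p1] and [p2] to the infinite points of the axes and [p3] to the origin. The eight points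
    other than [p1] and [p2] are then affine, and both coordinates are injective on them. Once
    normalized they form a graph to which [hyperbola] applies, and (X : 1/X : 1) = (X^2 : 1 : X) is
    a point of the standard conic. *)
Lemma oval_conic : exists2 g : 'M[F]_3, g \in unitmx &
  [/\ O = [set pt (g *m conic_pt t) | t : option F],
      p1 = pt (g *m conic_pt None), p2 = pt (g *m conic_pt (Some 0))
    & p3 = pt (g *m conic_pt (Some 1))].
Proof.
have [A [uA A1 A2 A3]] := oval_frame.
pose w (p : pg_point F) := A *m val (repr p).
pose O' := O :\ p1 :\ p2.
have O'P p : (p \in O') = [&& p != p2, p != p1 & p \in O] by rewrite !inE.
have cardO' : #|F| = #|O'|.+1.
  have [+ _] := hO; rewrite /= hF (cardsD1 p1) (cardsD1 p2) p1O !inE eq_sym p12 p2O.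
  by rewrite !add1n => -[->].
have wE p : w p = cv (w p i0 0) (w p i1 0) (w p i2 0) by apply: cv_eta.
have lineE a b c p : (rv a b c *m (A *m val (repr p)) == 0) =
    (a * w p i0 0 + b * w p i1 0 + c * w p i2 0 == 0).
  by rewrite -/(w p) {1}(wE p) rv_mul_cv.
have line1 b c : rv 0 b c *m (A *m val (repr p1)) = 0.
  by apply/eqP; rewrite A1 rv_mul_cv mul0r !mulr0 !addr0.
have line2 a c : rv a 0 c *m (A *m val (repr p2)) = 0.
  by apply/eqP; rewrite A2 rv_mul_cv mul0r !mulr0 !addr0.
(* The line at infinity already contains [p1] and [p2]. *)
have w2 p : p \in O' -> w p i2 0 != 0.
  rewrite O'P => /and3P[pp2 pp1 pO]; rewrite eq_sym in pp2; rewrite eq_sym in pp1.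
  have r0 : rv 0 0 1 != 0 :> 'rV[F]_3 by rewrite rv_eq0 oner_eq0 !andbF.
  have := oval_no_line uA r0 p1O p2O pO p12 pp2 pp1 (line1 _ _) (line2 _ _).
  by rewrite lineE !mul0r !add0r mul1r.
pose x p := w p i0 0 / w p i2 0.
pose y p := w p i1 0 / w p i2 0.
(* Points with equal [x] lie on a line through [p2]; likewise for [y] and [p1]. *)
have x_inj : {in O' &, injective x}.
  move=> p q pO' qO' e; apply/eqP; apply: contraT => pq.
  have xE s : s \in O' -> x s = x p -> rv 1 0 (- x p) *m (A *m val (repr s)) = 0.
    move=> sO' <-; apply/eqP.
    by rewrite lineE mul1r mul0r addr0 mulNr divfK ?w2 // subrr.
  have [ep eq] := (xE p pO' erefl, xE q qO' (esym e)).
  move: pO' qO'; rewrite !O'P => /and3P[pp2 pp1 pO] /and3P[qp2 qp1 qO].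
  have r0 : rv 1 0 (- x p) != 0 by rewrite rv_eq0 oner_eq0.
  have := oval_no_line uA r0 pO qO p2O pq qp2 pp2 ep eq.
  by rewrite line2 eqxx.
have y_inj : {in O' &, injective y}.
  move=> p q pO' qO' e; apply/eqP; apply: contraT => pq.
  have yE s : s \in O' -> y s = y p -> rv 0 1 (- y p) *m (A *m val (repr s)) = 0.
    move=> sO' <-; apply/eqP.
    by rewrite lineE mul1r mul0r add0r mulNr divfK ?w2 // subrr.
  have [ep eq] := (yE p pO' erefl, yE q qO' (esym e)).
  move: pO' qO'; rewrite !O'P => /and3P[pp2 pp1 pO] /and3P[qp2 qp1 qO].
  have r0 : rv 0 1 (- y p) != 0 by rewrite rv_eq0 oner_eq0 andbF.
  have := oval_no_line uA r0 pO qO p1O pq qp1 pp1 ep eq.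
  by rewrite line1 eqxx.
have p3O' : p3 \in O' by rewrite O'P p3O eq_sym p23 eq_sym p13.
(* Geometrically, the missing abscissa is that of the tangent at [p2], and the missing ordinate that
   of the tangent at [p1]. *)
have [x0 x0P] := missing_value x_inj cardO'.
have [y0 y0P] := missing_value y_inj cardO'.
have x00 : x0 != 0.
  rewrite eq_sym -x0P; apply/imsetP; exists p3 => //.
  by rewrite /x -/(w p3) /w A3 !mxE mul0r.
have y00 : y0 != 0.
  rewrite eq_sym -y0P; apply/imsetP; exists p3 => //.
  by rewrite /y -/(w p3) /w A3 !mxE mul0r.
(* An affine change of coordinates moves the missing values to 0 and the
   coordinates of [p3] to (1, 1). *)
pose X p := 1 - x p / x0.
pose Y p := 1 - y p / y0.
have X0 p : p \in O' -> X p != 0.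
  move=> pO'; rewrite subr_eq0 eq_sym.
  have : x p != x0 by rewrite -x0P; apply: imset_f.
  by apply: contra => /eqP e; rewrite -[x p](divfK x00) e mul1r.
have Y0 p : p \in O' -> Y p != 0.
  move=> pO'; rewrite subr_eq0 eq_sym.
  have : y p != y0 by rewrite -y0P; apply: imset_f.
  by apply: contra => /eqP e; rewrite -[y p](divfK y00) e mul1r.
have X_inj : {in O' &, injective X}.
  move=> p q pO' qO' /addrI/oppr_inj/(mulIf (invr_neq0 x00)); exact: x_inj.
have Y_inj : {in O' &, injective Y}.
  move=> p q pO' qO' /addrI/oppr_inj/(mulIf (invr_neq0 y00)); exact: y_inj.
have X_onto a : a != 0 -> exists2 p, p \in O' & X p = a.
  move=> a0; have /imsetP[p pO' e] : x0 * (1 - a) \in x @: O'.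
    rewrite x0P -subr_eq0 mulrBr mulr1 addrC addrA addNr add0r oppr_eq0.
    by rewrite mulf_neq0.
  by exists p => //; rewrite /X -e [_ / _]mulrC mulKf //; ring.
(* The affine part of the oval is the graph of [f] over the nonzero elements. As [X] takes exactly
   the nonzero values, the default is used only at 0. *)
pose f a := if [pick p in O' | X p == a] is Some p then Y p else 0.
have fX p : p \in O' -> f (X p) = Y p.
  move=> pO'; rewrite /f; case: pickP => [q /andP[qO' /eqP e]|/(_ p)].
    by congr Y; apply: X_inj.
  by rewrite pO' eqxx.
(* The homogeneous matrix of the change from (x, y) to (X, Y). *)
pose N : 'M[F]_3 := \matrix_(i, j)
  nth 0 (nth [::] [:: [:: - x0^-1; 0; 1]; [:: 0; - y0^-1; 1]; [:: 0; 0; 1]] i) j.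
have N_cv a b c : N *m cv a b c = cv (c - a / x0) (c - b / y0) c.
  by rewrite [LHS]cv_eta !mxE !sum3 !mxE /=; congr cv; ring.
have uN : N \in unitmx.
  rewrite -unitmx_tr -row_free_unit -kermx_eq0 -nz_row_eq0; apply: contraT.
  set r := nz_row _; rewrite -trmx_eq0.
  have : N *m r^T = 0.
    by apply: trmx_inj; rewrite trmx_mul trmxK trmx0; apply/sub_kermxP/nz_row_sub.
  rewrite [r^T]cv_eta N_cv => /eqP; rewrite !cv_eq0 => /and3P[e1 e2 /eqP e3].
  rewrite e3 !sub0r !oppr_eq0 !mulf_eq0 !invr_eq0 (negPf x00) (negPf y00) !orbF in e1 e2.
  by rewrite e1 e2 e3 eqxx.
pose G := N *m A.
have uG : G \in unitmx by rewrite unitmx_mul uN.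
have GE p : p \in O' -> G *m val (repr p) = w p i2 0 *: cv (X p) (Y p) 1.
  move=> /w2 wp; rewrite -mulmxA -/(w p) {1}(wE p) N_cv scale_cv /X /Y /x /y mulr1.
  by congr cv; field; rewrite wp ?x00 ?y00.
have XY p : p \in O' -> X p * Y p = 1.
  move=> pO'; rewrite -fX //; apply: (hyperbola hF); last exact: X0.
  - by move=> a /X_onto[q qO' <-]; rewrite fX ?Y0.
  - move=> a b /X_onto[q qO' <-] /X_onto[s sO' <-]; rewrite !fX //.
    by apply: contra => /eqP/Y_inj->.
  - move=> a b c /X_onto[q qO' <-] /X_onto[s sO' <-] /X_onto[t tO' <-].
    rewrite !fX // => qs st qt; apply/eqP => e.
    have neq u v : X u != X v -> u != v by apply: contra => /eqP->.
    have mO u : u \in O' -> u \in O by rewrite O'P => /and3P[].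
    (* This row is the line through the images of [q] and [s]. *)
    have r0 : rv (Y q - Y s) (X s - X q) (X q * Y s - X s * Y q) != 0.
      by rewrite rv_eq0 negb_and negb_and [X s - _ == 0]subr_eq0 [X s == _]eq_sym qs orbT.
    have onG u : u \in O' ->
        (Y q - Y s) * X u + (X s - X q) * Y u + (X q * Y s - X s * Y q) = 0 ->
        rv (Y q - Y s) (X s - X q) (X q * Y s - X s * Y q) *m (G *m val (repr u)) = 0.
      move=> uO' eu; rewrite GE // -scalemxAr; apply/eqP.
      by rewrite scaler_eq0 rv_mul_cv mulr1 eu eqxx orbT.
    have := oval_no_line uG r0 (mO _ qO') (mO _ sO') (mO _ tO')
      (neq _ _ qs) (neq _ _ st) (neq _ _ qt).
    rewrite !onG ?eqxx //; [by move=> /(_ erefl erefl)| |ring|ring].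
    transitivity ((X s - X q) * (Y t - Y q) - (X t - X q) * (Y s - Y q)); first by ring.
    by rewrite e subrr.
  - have <- : X p3 = 1 by rewrite /X /x /w A3 !mxE !mul0r subr0.
    by rewrite fX // /Y /X /x /y /w A3 !mxE !mul0r.
have uG' : invmx G \in unitmx by rewrite unitmx_inv.
have GK (v : 'cV[F]_3) : invmx G *m (G *m v) = v by rewrite mulKmx.
have G_neq0 t : invmx G *m conic_pt t != 0.
  apply: contraNneq (conic_pt_neq0 t) => e.
  by rewrite -(mulKVmx uG (conic_pt t)) e mulmx0.
have pt_of p t a : G *m val (repr p) = a *: conic_pt t ->
    p = pt (invmx G *m conic_pt t).
  move=> e; have a0 : a != 0.
    apply: contraNneq (valP (repr p)) => a0.
    by rewrite -[val _]GK e a0 scale0r mulmx0.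
  apply: (@pt_eq _ _ _ a^-1) => //.
  by rewrite -[val (repr p)]GK e -scalemxAr scalerA mulVf // scale1r.
have p1E : p1 = pt (invmx G *m conic_pt None).
  apply: (@pt_of _ _ (- x0^-1)).
  by rewrite -mulmxA A1 N_cv scale_cv; congr cv; ring.
have p2E : p2 = pt (invmx G *m conic_pt (Some 0)).
  apply: (@pt_of _ _ (- y0^-1)).
  by rewrite -mulmxA A2 N_cv scale_cv; congr cv; ring.
have ptE p : p \in O' -> p = pt (invmx G *m conic_pt (Some (X p))).
  move=> pO'; apply: (@pt_of _ _ (w p i2 0 / X p)); rewrite GE // !scale_cv.
  have -> : Y p = (X p)^-1 by apply: (mulfI (X0 _ pO')); rewrite XY ?divff ?X0.
  by congr cv; field; rewrite X0.
exists (invmx G) => //; split=> //; last first.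
  by rewrite {1}(ptE _ p3O'); congr (pt (_ *m conic_pt (Some _)));
     rewrite /X /x /w A3 !mxE !mul0r subr0.
(* The oval has ten points and there are ten parameters, so one inclusion is enough. *)
apply/eqP; rewrite eqEcard; apply/andP; split.
  apply/subsetP=> p pO; apply/imsetP.
  have [->|pp1] := eqVneq p p1; first by exists None.
  have [->|pp2] := eqVneq p p2; first by exists (Some 0).
  exists (Some (X p)); first by [].
  by apply: ptE; rewrite O'P pp1 pp2 pO.
have [-> _] := hO; rewrite /= hF; apply: leq_trans (leq_imset_card _ _) _.
by rewrite card_option hF.
Qed.

End Oval.

(** * Poncelet polygons *)

Lemma next_neq (T : eqType) (c : seq T) x :
  uniq c -> (1 < size c)%N -> x \in c -> x != next c x.
Proof.
move=> uc sc xc; have [i s cE] := rot_to xc.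
rewrite -(next_rot i) // cE; move: uc sc; rewrite -(rot_uniq i) -(size_rot i) cE.
by case: s {cE} => [//|y s] /= /andP[]; rewrite inE negb_or eqxx => /andP[].
Qed.

(** * Quadratic forms on lines *)

Section Forms.

Variable F : finFieldType.
Hypothesis hF : #|F| = 9%N.

Definition qform (S : 'M[F]_3) (u : 'rV[F]_3) : F := (u *m S *m u^T) 0 0.

Lemma qform_mul S (k : 'M[F]_3) u : qform S (u *m k) = qform (k *m S *m k^T) u.
Proof. by rewrite /qform trmx_mul !mulmxA. Qed.

Lemma qform_scale S a u : qform S (a *: u) = a ^+ 2 * qform S u.
Proof.
rewrite /qform -!scalemxAl linearZ -scalemxAr !mxE; ring.
Qed.

(** In characteristic 3 the factor 2 of the mixed terms is -1. *)
Lemma qformE S x y z : S^T = S ->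
  qform S (rv x y z) = S i0 i0 * x ^+ 2 + S i1 i1 * y ^+ 2 + S i2 i2 * z ^+ 2
    - (S i0 i1 * (x * y) + S i0 i2 * (x * z) + S i1 i2 * (y * z)).
Proof.
move=> St; have Sji i j : S i j = S j i by rewrite -{1}St mxE.
rewrite /qform !mxE sum3 !mxE !sum3 !mxE /= (Sji i1 i0) (Sji i2 i0) (Sji i2 i1).
apply/eqP; rewrite -subr_eq0; apply/eqP.
rewrite -[RHS](mul0r (S i0 i1 * (x * y) + S i0 i2 * (x * z) + S i1 i2 * (y * z))).
by rewrite -(nat3_eq0 hF); ring.
Qed.

(** For the standard conic the discriminant condition z^2 = 4xy reads z^2 - xy = 0 in characteristic
    3, which is the form of [M0]. A line [l] is tangent to the image of the conic under [h] when
    [l *m h] is tangent to the conic, whence the matrix [h *m M0 *m h^T]. *)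
Lemma oval_tangent_form (O : {set pg_point F}) : @oval (PG2 F) O ->
  exists Q : 'M[F]_3, [/\ Q \in unitmx, Q^T = Q &
    forall l : pg_line F, @tangent (PG2 F) O l -> qform Q (val (repr l)) = 0].
Proof.
move=> hO; have [cO _] := hO; rewrite /= hF in cO.
have /card_gt2P[q1 [q2 [q3 [[q1O q2O q3O] [q12 q23 q31]]]]] : (2 < #|O|)%N by rewrite cO.
rewrite eq_sym in q31.
have [h uh [OE _ _ _]] := oval_conic hF hO q1O q2O q3O q12 q23 q31.
have h_neq0 t : h *m conic_pt t != 0.
  apply: contraNneq (conic_pt_neq0 t) => e.
  by rewrite -(mulKmx uh (conic_pt t)) e mulmx0.
have pt_inj : injective (fun t => pt (h *m conic_pt t)).
  (* The oval has as many points as there are parameters. *)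
  have /imset_injP : #|[set pt (h *m conic_pt t) | t : option F]| == #|{: option F}|.
    by rewrite -OE cO card_option hF.
  by move=> inj t t'; apply: inj.
pose M0 : 'M[F]_3 := \matrix_(i, j)
  nth 0 (nth [::] [:: [:: 0; 1; 0]; [:: 1; 0; 0]; [:: 0; 0; 1]] i) j.
have M0t : M0^T = M0.
  by apply/matrixP=> [[[|[|[|//]]] ?] [[|[|[|//]]] ?]]; rewrite !mxE.
have uM0 : M0 \in unitmx.
  have /mulmx1_unit[] // : M0 *m M0 = 1%:M.
  by apply/matrixP=> [[[|[|[|//]]] ?] [[|[|[|//]]] ?]]; rewrite !mxE sum3 !mxE /=; ring.
exists (h *m M0 *m h^T); split; first by rewrite !unitmx_mul unitmx_tr uh uM0.
  by rewrite !trmx_mul trmxK M0t mulmxA.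
move=> l /cards1P[p pE]; rewrite -qform_mul.
have : p \in [set p in O | pg_inc p l] by rewrite pE inE.
rewrite inE OE => /andP[/imsetP[t0 _ ep] _].
have r_conic t : (val (repr l) *m h *m conic_pt t == 0) = (t == t0).
  rewrite -mulmxA -pg_inc_pt // -(inj_eq pt_inj) -ep -in_set1 -pE inE andb_idl // => _.
  by rewrite OE; apply/imsetP; exists t.
have := conic_tangent r_conic; move: (_ *m h) => r e.
rewrite [r]rv_eta qformE // !mxE /= e.
transitivity (3%:R * (r 0 i0 * r 0 i1)); first by ring.
by rewrite (nat3_eq0 hF) mul0r.
Qed.

(** The two zeros give [S i2 i2 = 0] and [S i0 i2 = - S i0 i0]. Dividing by [S i0 i0], nonzero since
    [S] is invertible, leaves three coefficients, and the expression in them is the determinant of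
    the scaled matrix. *)
Lemma conic_edge (S : 'M[F]_3) : S \in unitmx -> S^T = S ->
  qform S (conic_secant None (Some 0)) = 0 ->
  qform S (conic_secant (Some 0) (Some 1)) = 0 ->
  exists b d f, f * (d - f) - b != 0 /\
    forall s t, s != t -> qform S (conic_secant s t) = 0 -> edge b d f s t.
Proof.
move=> uS St; have Sji i j : S i j = S j i by rewrite -{1}St mxE.
pose A := S i0 i0; pose B := S i1 i1; pose D := S i0 i1; pose G := S i1 i2.
rewrite !qformE // -/A -/B -/D -/G => e1 e2.
have C0 : S i2 i2 = 0 by rewrite -e1; ring.
have E0 : S i0 i2 = - A.
  by apply/eqP; rewrite -addr_eq0 -e2 C0; apply/eqP; ring.
have mulS x y z : rv x y z *m S =
    rv (x * A + y * D - z * A) (x * D + y * B + z * G) (y * G - x * A).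
  rewrite [LHS]rv_eta !mxE !sum3 !mxE /= (Sji i1 i0) (Sji i2 i0) (Sji i2 i1) E0 C0.
  by rewrite -/A -/B -/D -/G; congr rv; ring.
have S_inj x y z : rv x y z *m S = 0 -> rv x y z = 0.
  by move=> e; rewrite -(mulmxK uS (rv x y z)) e mul0mx.
have A0 : A != 0.
  (* With [A = 0] the first and last rows of [S] are (0, D, 0) and (0, G, 0), and this combination
     cancels them. *)
  apply/eqP=> A0; have /S_inj/eqP : rv G 0 (- D) *m S = 0.
    by rewrite mulS A0; apply/eqP; rewrite rv_eq0; apply/and3P; split; apply/eqP; ring.
  rewrite rv_eq0 oppr_eq0 => /and3P[/eqP G0 _ /eqP D0].
  have /S_inj/eqP : rv 1 0 0 *m S = 0.
    by rewrite mulS A0 D0; apply/eqP; rewrite rv_eq0; apply/and3P; split; apply/eqP; ring.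
  by rewrite rv_eq0 oner_eq0.
exists (B / A), (D / A), (G / A); split.
  apply/eqP=> det0.
  (* the cross product of the first and last rows of S, up to a factor *)
  have /S_inj/eqP : rv G A (G + D) *m S = 0.
    rewrite mulS; apply/eqP; rewrite rv_eq0; apply/and3P; split; apply/eqP; [ring| |ring].
    transitivity (- A ^+ 2 * (G / A * (D / A - G / A) - B / A) + 3%:R * D * G).
      by field.
    by rewrite det0 (nat3_eq0 hF); ring.
  by rewrite rv_eq0 (negPf A0) andbF.
move=> s t st; suff e : qform S (conic_secant s t) = 0 -> edge (B / A) (D / A) (G / A) s t.
  exact: e.
rewrite /edge; case: s t st => [s|] [t|] // _; rewrite qformE // -/A -/B -/D -/G E0 C0 => e;
  apply/eqP; apply: (mulfI A0); rewrite mulr0 -[RHS]e; by field.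
Qed.

(** The coordinates come from the first polygon alone: its first three vertices get the parameters
    oo, 0, 1, which normalizes the form. In these coordinates both polygons are cycles of one
    graph. *)
Lemma polygon_size (Ot Os : {set pg_point F}) m m' (s : m.-tuple (pg_point F))
    (s' : m'.-tuple (pg_point F)) :
  @oval (PG2 F) Ot -> @oval (PG2 F) Os ->
  @poncelet_polygon (PG2 F) Ot Os m s -> @poncelet_polygon (PG2 F) Ot Os m' s' ->
  m = m'.
Proof.
move=> hOt hOs [/andP[m3 _] us sO cs] [/andP[m3' _] us' sO' cs'].
have [Q [uQ Qt tangentQ]] := oval_tangent_form hOt.
have [p1 [p2 [p3 [r sE]]]] : exists p1 p2 p3 r, tval s = [:: p1, p2, p3 & r].
  move: m3; rewrite -{1}(size_tuple s); case: (tval s) => [|p1 [|p2 [|p3 r]]] // _.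
  by exists p1, p2, p3, r.
have [p1O p2O p3O] : [/\ p1 \in Os, p2 \in Os & p3 \in Os].
  have /allP : {subset tval s <= Os} by [].
  by rewrite sE => /and4P[].
have [p12 p23 p13] : [/\ p1 != p2, p2 != p3 & p1 != p3].
  move: us; rewrite sE !cons_uniq !in_cons !negb_or.
  by move=> /and3P[/and3P[h12 h13 _] /andP[h23 _] _]; exact: And3 h12 h23 h13.
have [g ug [OsE p1E p2E p3E]] := oval_conic hF hOs p1O p2O p3O p12 p23 p13.
have g_neq0 t : g *m conic_pt t != 0.
  apply: contraNneq (conic_pt_neq0 t) => e.
  by rewrite -(mulKmx ug (conic_pt t)) e mulmx0.
(* [S] is the form [Q] in the coordinates where [Os] is the standard conic; a line [l] has there the
   coordinates [l *m g]. *)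
pose S := invmx g *m Q *m (invmx g)^T.
have uS : S \in unitmx by rewrite !unitmx_mul unitmx_tr unitmx_inv ug uQ.
have St : S^T = S by rewrite !trmx_mul trmxK Qt mulmxA.
have tangentS t t' : t != t' ->
    @tangent_join (PG2 F) Ot (pt (g *m conic_pt t)) (pt (g *m conic_pt t')) ->
    qform S (conic_secant t t') = 0.
  move=> tt' /existsP[l /and3P[]]; rewrite /= !pg_inc_pt // !mulmxA.
  move=> /eqP lt /eqP lt' /tangentQ.
  have [a e] := conic_secantP tt' lt lt'.
  have a0 : a != 0.
    apply: contraNneq (valP (repr l)) => a0.
    by rewrite -(mulmxK ug (val (repr l))) e a0 scale0r mul0mx.
  rewrite -(mulmxK ug (val (repr l))) e -scalemxAl qform_scale qform_mul => /eqP.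
  by rewrite mulf_eq0 expf_eq0 (negPf a0) => /eqP.
have [b [d [f [det_neq0 edgeP]]]] : exists b d f, f * (d - f) - b != 0 /\
    forall t t', t != t' -> qform S (conic_secant t t') = 0 -> edge b d f t t'.
  move: cs; rewrite sE => /and3P[c12 c23 _].
  apply: conic_edge => //; apply: tangentS.
  - by [].
  - by rewrite -p1E -p2E.
  - by apply: contra (oner_neq0 F) => /eqP[<-].
  - by rewrite -p2E -p3E.
have [code codeK] : exists code, forall p, p \in Os -> pt (g *m conic_pt (code p)) = p.
  (* Every point of [Os] has a parameter, so the default is never taken on [Os]. *)
  exists (fun p => odflt None [pick t | pt (g *m conic_pt t) == p]).
  move=> p; rewrite OsE => /imsetP[t _ ->].
  by case: pickP => [t' /eqP //|/(_ t)]; rewrite eqxx.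
have code_inj : {in Os &, injective code}.
  by move=> p q pO qO e; rewrite -(codeK p pO) e; exact: codeK q qO.
have cycleP (c : seq (pg_point F)) : uniq c -> (1 < size c)%N -> {subset c <= Os} ->
    path.cycle (@tangent_join (PG2 F) Ot) c ->
    uniq (map code c) /\ path.cycle (edge b d f) (map code c).
  move=> uc sc cO cc; split.
      rewrite map_inj_in_uniq; first exact: uc.
    by move=> p q pc qc; exact: code_inj (cO p pc) (cO q qc).
  rewrite cycle_map; apply: cycle_from_next; first exact: uc.
  move=> p pc; have nc : next c p \in c by rewrite mem_next.
  (* The side is the secant of two parameters only if these are distinct. *)
  have code_neq : code p != code (next c p).
    rewrite (inj_in_eq code_inj (cO _ pc) (cO _ nc)); exact: next_neq uc sc pc.
  apply: (edgeP _ _ code_neq); apply: (tangentS _ _ code_neq).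
  rewrite (codeK p (cO p pc)) (codeK _ (cO _ nc)); exact: next_cycle cc pc.
have [|uc cc] := cycleP _ us _ sO cs; first by rewrite size_tuple ltnW.
have [|uc' cc'] := cycleP _ us' _ sO' cs'; first by rewrite size_tuple ltnW.
have sz : (2 < size (map code s))%N by rewrite size_map size_tuple.
have sz' : (2 < size (map code s'))%N by rewrite size_map size_tuple.
have := edge_cycles_same_size hF det_neq0 uc sz cc uc' sz' cc'.
by rewrite !size_map !size_tuple.
Qed.

End Forms.

(** * The trichotomy for pairs of ovals *)

Theorem theorem1 (F : finFieldType) (hF : #|F| = 9%N) : poncelet_plane (PG2 F).
Proof.
move=> Ot Os hOt hOs.
have unique m m' : has_poncelet_polygon Ot Os m -> has_poncelet_polygon Ot Os m' ->
    m' = m.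
  by move=> [s hs] [s' hs']; exact: (polygon_size hF hOt hOs hs' hs).
(* A boolean version, so that the existence of a polygon is decided by enumeration. *)
pose polygonb m := [exists s : m.-tuple (point (PG2 F)),
  [&& uniq s, [forall p in s, p \in Os] & path.cycle (tangent_join Ot) s]].
have polygonP m : (3 <= m <= (plane_order (PG2 F)).+1)%N ->
    reflect (has_poncelet_polygon Ot Os m) (polygonb m).
  move=> hm; apply: (iffP existsP) => -[s].
    by case/and3P=> us /forall_inP sO cs; exists s; split.
  by case=> _ us sO cs; exists s; rewrite us cs andbT; apply/forall_inP.
pose M := (plane_order (PG2 F)).+1.
(* If a polygon exists, [unique] makes the pair an m-pair. Otherwise the existence of a secant of
   [Os] tangent to [Ot] decides between an infinity-pair and a 0-pair. *)
case: (boolP [exists m : 'I_M.+1, (2 < m)%N && polygonb m]) => [/existsP[m /andP[m3 pm]]|].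
  have hm : (3 <= m <= M)%N by rewrite m3 -ltnS ltn_ord.
  move/(polygonP _ hm): pm => hasm; constructor 1; exists m; split=> //.
  by move=> m' _ /eqP mm' /(unique _ _ hasm).
rewrite negb_exists => /forallP no_polygon.
case: (boolP [exists l, secant Os l && tangent Ot l]) => [/existsP tl|].
  constructor 3; split=> // m hm /(polygonP _ hm) pm.
  have /andP[m3 mM] := hm.
  by have := no_polygon (Ordinal (mM : (m < M.+1)%N)); rewrite m3 pm.
rewrite negb_exists => /forallP no_tangent; constructor 2 => l sl.
by have := no_tangent l; rewrite sl.
Qed.
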